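(* Let $T>0$, let $(f_t)_{t\in[0,T]}$ be a family of convex differentiable functions $f_t:\mathbb{R}^d\to\mathbb{R}$ and let $(A_t)_{t\in[0,T]}$ be a family of skew-symmetric matrices in $\mathbb{R}^{d\times d}$. Define $$F_t(x)=-\nabla_x f_t(x)+A_t x,\qquad x\in\mathbb{R}^d,\ t\in[0,T].$$ Then the flow associated with $F_t$ satisfies, for all initial conditions $x_0$ and $z_0$ and all $t\in[0,T]$, $$\lVert x_t-z_t\rVert\le\lVert x_0-z_0\rVert.$$
   Context: $\lVert\cdot\rVert$ is the Euclidean norm on $\mathbb{R}^d$. The flow associated with $F_t$ with initial condition $x_0$ is a solution $t\mapsto x_t\in\mathbb{R}^d$ of $\frac{dx_t}{dt}=F_t(x_t)$ for $t\in[0,T]$ with value $x_0$ at $t=0$; $x_t$ and $z_t$ denote two such solutions on $[0,T]$ (assumed to exist) with initial values $x_0$ and $z_0$. *)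

(* Defs.v *)
From mathcomp Require Import all_boot all_order all_algebra.
From mathcomp Require Import all_classical all_reals all_analysis.
Set Implicit Arguments.
Unset Strict Implicit.
Unset Printing Implicit Defensive.
Import Order.TTheory GRing.Theory Num.Theory.
Import numFieldNormedType.Exports.
Local Open Scope classical_set_scope.
Local Open Scope ring_scope.

(* The canonical norm `|x| on 'cV[R]_d is the sup norm, not the Euclidean one.
   It induces the same topology, hence the same limits and differentials. *)
Definition enorm (R : realType) (d : nat) (x : 'cV[R]_d) : R :=
  Num.sqrt (\sum_(i < d) x i 0 ^+ 2).

(* The vector of partial derivatives along the canonical basis. *)
Definition gradient (R : realType) (d : nat) (g : 'cV[R]_d -> R)
    (x : 'cV[R]_d) : 'cV[R]_d :=
  \col_(i < d) 'D_(delta_mx i 0) g x.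

(* Derivative relative to D: difference quotients are taken at points s of D
   only, so at an endpoint of D = `[a, b] this is the one-sided derivative. *)
Definition has_derivative_within (R : realType) (d : nat) (D : set R)
    (x : R -> 'cV[R]_d) (t : R) (v : 'cV[R]_d) : Prop :=
  (s - t)^-1 *: (x s - x t) @[s --> within D t^'] --> v.

(* Time-dependent objects are indexed by all of R; only their values
   at times in [0, T] are ever used. *)
Definition is_flow (R : realType) (d : nat) (T : R)
    (F : R -> 'cV[R]_d -> 'cV[R]_d) (x0 : 'cV[R]_d)
    (x : R -> 'cV[R]_d) : Prop :=
  x 0 = x0 /\
  forall t : R, t \in `[0, T] -> has_derivative_within `[0, T] x t (F t (x t)).

Definition flow_field (R : realType) (d : nat) (f : R -> 'cV[R]_d -> R)
    (A : R -> 'M[R]_d) (t : R) (x : 'cV[R]_d) : 'cV[R]_d :=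
  - gradient (f t) x + A t *m x.

(* Main.v *)
(* With w = x - z, the derivative of |w|^2 is 2 <F_t(x) - F_t(z), w>. The skew
   part of F_t contributes nothing to it, and the gradient part is nonpositive
   because the gradient of a convex function is monotone; so |w|^2 is
   nonincreasing on [0, T]. *)
Require Import Defs.
From mathcomp Require Import all_boot all_order all_algebra.
From mathcomp Require Import all_classical all_reals all_analysis.
From mathcomp Require Import ring lra.
Import Order.TTheory GRing.Theory Num.Theory.
Import numFieldNormedType.Exports.
Local Open Scope classical_set_scope.
Local Open Scope ring_scope.

Set Implicit Arguments.
Unset Strict Implicit.
Unset Printing Implicit Defensive.

(** First-order condition for convexity: for [0 < h <= 1], convexity on the segment from [x] to [y]
    bounds the difference quotient of step [h] by [g y - g x], and the bound survives the limit as
    [h] decreases to 0. *)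
Lemma convex_derive_le (R : realType) (V : normedModType R) (g : V -> R)
    (x y : V) :
  @convex_function R V setT g -> differentiable g x ->
  'D_(y - x) g x <= g y - g x.
Proof.
move=> cvx_g /(diff_derivable (v := y - x)) dg.
have := cvg_dnbhs_at_right dg; rewrite -/(derive g x (y - x)) => Dg.
apply: (cvgr_to_le Dg); near=> h.
have h0 : 0 < h by near: h; exact: nbhs_right_gt.
have h1 : h <= 1 by near: h; exact: nbhs_right_le.
(* The weight [h] goes to [y], so that the convex combination is the point [x + h (y - x)] of the
   quotient. *)
have := cvx_g (Itv01 (ltW h0) h1) y x (in_setT y) (in_setT x).
rewrite convRE /= {1}/conv /= /unstable.onem => le_g.
have xyE : h *: (y - x) + x = h *: y + (1 - h) *: x.
  by rewrite scalerBr scalerBl scale1r -addrA (addrC (- _)).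
rewrite /= xyE /GRing.scale /= ler_pdivrMl // lerBlDr.
by apply: le_trans le_g _; rewrite le_eqVlt; apply/orP; left; apply/eqP; ring.
Unshelve. all: by end_near. Qed.

(** Differentiability makes the derivative linear in the direction, so [v] can be expanded in the
    canonical basis. *)
Lemma derive_gradient (R : realType) (d : nat) (g : 'cV[R]_d -> R)
    (x v : 'cV[R]_d) :
  differentiable g x -> 'D_v g x = ((gradient g x)^T *m v) 0 0.
Proof.
move=> dg; rewrite deriveE // {1}(matrix_sum_delta v) linear_sum mxE.
apply: eq_bigr => i _; rewrite big_ord1 linearZ -deriveE // !mxE.
exact: mulrC.
Qed.

(** Add the first-order conditions from [x] to [y] and from [y] to [x]: the values of [g] cancel. *)
Lemma gradient_monotone (R : realType) (d : nat) (g : 'cV[R]_d -> R)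
    (x y : 'cV[R]_d) :
  @convex_function R 'cV[R]_d setT g -> (forall u, differentiable g u) ->
  0 <= ((gradient g x - gradient g y)^T *m (x - y)) 0 0.
Proof.
move=> cvx_g dg.
have := convex_derive_le y cvx_g (dg x).
have := convex_derive_le x cvx_g (dg y).
rewrite !derive_gradient // [(_ - _)^T]linearB mulmxBl -(opprB x y) mulmxN !mxE.
lra.
Qed.

(** The product is a 1 x 1 matrix, hence its own transpose, while skew-symmetry makes that transpose
    its opposite. *)
Lemma skew_quadratic_form0 (R : realType) (d : nat) (A : 'M[R]_d)
    (w : 'cV[R]_d) :
  A^T = - A -> ((A *m w)^T *m w) 0 0 = 0.
Proof.
move=> skewA; set q := _ *m w.
have : q^T = - q by rewrite /q !trmx_mul !trmxK skewA mulmxN mulNmx opprK mulmxA.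
by move/matrixP/(_ 0 0); rewrite !mxE; lra.
Qed.

Lemma has_derivative_withinB (R : realType) (d : nat) (D : set R)
    (x y : R -> 'cV[R]_d) (t : R) (u v : 'cV[R]_d) :
  has_derivative_within D x t u -> has_derivative_within D y t v ->
  has_derivative_within D (fun s => x s - y s) t (u - v).
Proof.
move=> dx dy; rewrite /has_derivative_within.
under eq_fun do rewrite opprD addrACA scalerDr -opprD scalerN.
exact: cvgB.
Qed.

Lemma has_derivative_within_coord (R : realType) (d : nat) (D : set R)
    (x : R -> 'cV[R]_d) (t : R) (v : 'cV[R]_d) (i : 'I_d) :
  has_derivative_within D x t v ->
  (s - t)^-1 * (x s i 0 - x t i 0) @[s --> within D t^'] --> v i 0.
Proof.
move=> dx; have := cvg_comp _ _ dx (@coord_continuous R d 1 i 0 v).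
by apply: cvg_trans; apply: near_eq_cvg; near=> s; rewrite /= !mxE.
Unshelve. all: by end_near. Qed.

(** Differentiability implies continuity: off [t], the coordinate at [s] is its value at [t] plus
    [s - t] times the difference quotient, and that product tends to 0. *)
Lemma has_derivative_within_cvg (R : realType) (d : nat) (D : set R)
    (x : R -> 'cV[R]_d) (t : R) (v : 'cV[R]_d) (i : 'I_d) :
  has_derivative_within D x t v ->
  x s i 0 @[s --> within D (nbhs t)] --> x t i 0.
Proof.
move=> /(has_derivative_within_coord (i := i)) dx.
have st : s - t @[s --> within D t^'] --> (0 : R).
  rewrite -(subrr t); apply: cvgB; last exact: cvg_cst.
  do 2!apply: cvg_within_filter; exact: cvg_id.
have cv : x s i 0 @[s --> within D t^'] --> x t i 0.
  have /(_ _ _ _) := cvgD (cvgM st dx) (cvg_cst (x t i 0)).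
  rewrite mul0r add0r.
  apply: cvg_trans; apply: near_eq_cvg.
  have neq_t : \forall s \near within D t^', s != t.
    by rewrite near_withinE; near=> s => _; near: s; exact: nbhs_dnbhs_neq.
  near=> s; have st' : s - t != 0 by rewrite subr_eq0; near: s.
  by rewrite fctE /= mulVKf // subrK.
(* The limit [cv] avoids [s = t]; that point is restored here, since the value there is the limit
   itself. *)
move=> P Pt; have := cv _ Pt; rewrite /within /= /dnbhs /within /= => nP.
change (\forall s \near t, D s -> P (x s i 0)); near=> s => Ds.
have [->|st'] := eqVneq s t; first exact: nbhs_singleton.
by move: st' Ds; near: s.
Unshelve. all: by end_near. Qed.

(** At an interior point of [D] the restriction to [D] is vacuous near [t]; what remains is the
    substitution [s = h + t]. *)
Lemma has_derivative_within_is_derive (R : realType) (d : nat) (D : set R)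
    (x : R -> 'cV[R]_d) (t : R) (v : 'cV[R]_d) (i : 'I_d) :
  nbhs t D -> has_derivative_within D x t v ->
  is_derive t 1 (fun s => x s i 0) (v i 0).
Proof.
move=> tD /(has_derivative_within_coord (i := i)) dx.
suff cv : h^-1 *: (((fun s => x s i 0) \o shift t) (h *: 1) - x t i 0)
    @[h --> 0^'] --> v i 0.
  by split; [apply/cvg_ex; exists (v i 0)|exact/cvg_lim].
move=> P /dx; rewrite /within /= /dnbhs /within /= => nP.
have : \forall s \near t, s != t -> P ((s - t)^-1 * (x s i 0 - x t i 0)).
  by near=> s => st; have Ds : D s by [near: s]; move: st Ds; near: s.
rewrite (near_shift 0) subr0 /=; apply: filterS => h /= + h0.
rewrite addrK /GRing.scale /= mulr1; apply.
by rewrite -subr_eq0 addrK.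
Unshelve. all: by end_near. Qed.

Lemma enorm_nonincreasing (R : realType) (d : nat) (T : R)
    (w v : R -> 'cV[R]_d) :
  (forall t : R, t \in `[0, T] -> has_derivative_within `[0, T] w t (v t)) ->
  (forall t : R, t \in `[0, T] -> ((v t)^T *m w t) 0 0 <= 0) ->
  forall t : R, t \in `[0, T] -> enorm (w t) <= enorm (w 0).
Proof.
move=> dw vw0 t t0T; rewrite /enorm ler_wsqrtr //.
(* The squared norm is used because the norm itself may fail to be differentiable where [w]
   vanishes. *)
pose phi : R -> R := \sum_(i < d) (fun s => w s i 0) ^+ 2.
have phiE s : phi s = \sum_(i < d) w s i 0 ^+ 2.
  by rewrite /phi fct_sumE; apply: eq_bigr => i _.
have dphi s : s \in `]0, T[ -> is_derive s 1 phi (2 * ((v s)^T *m w s) 0 0).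
  move=> s0T; have s0T' := subset_itv_oo_cc s0T.
  have nD : nbhs s `[0, T]%classic.
    near=> r; rewrite /= subset_itv_oo_cc //.
    by near: r; exact: near_in_itvoo.
  apply: (is_derive_eq (f' := \sum_(i < d) (2 * w s i 0 ^+ 1) *: v s i 0)).
    apply: is_derive_sum => i; apply: is_deriveX.
    exact: has_derivative_within_is_derive nD (dw _ s0T').
  rewrite mxE mulr_sumr; apply: eq_bigr => i _.
  by rewrite mxE expr1 /GRing.scale /=; ring.
have [t_ge0 t_leT] : 0 <= t /\ t <= T by apply/andP; rewrite in_itv /= in t0T.
(* The sign of the derivative is needed only on the open interval; at the endpoints, the one-sided
   derivatives supply continuity. *)
rewrite -!phiE; apply: (@ler0_derive1_le_cc _ phi 0 T) => //.
- by move=> s /dphi[].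
- move=> s s0T; rewrite derive1E (@derive_val _ _ _ _ _ _ _ (dphi s s0T)).
  by rewrite pmulr_rle0 // vw0 // subset_itv_oo_cc.
- rewrite (funext phiE); apply/subspace_continuousP => s sD.
  apply: (cvg_big (op := +%R)) => [|i _]; first exact: add_continuous.
  rewrite expr2; under eq_fun do rewrite expr2.
  by apply: cvgM; exact: has_derivative_within_cvg (dw s sD).
- by rewrite in_itv /= lexx (le_trans t_ge0).
Unshelve. all: by end_near. Qed.

Theorem corollary1 (R : realType) (d : nat) (T : R)
    (f : R -> 'cV[R]_d -> R) (A : R -> 'M[R]_d)
    (hT : 0 < T)
    (fconvex : forall t : R, t \in `[0, T] ->
       @convex_function R 'cV[R]_d setT (f t))
    (fdiff : forall t : R, t \in `[0, T] ->
       forall x : 'cV[R]_d, differentiable (f t) x)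
    (Askew : forall t : R, t \in `[0, T] -> (A t)^T = - A t)
    (x0 z0 : 'cV[R]_d) (x z : R -> 'cV[R]_d)
    (hx : is_flow T (flow_field f A) x0 x)
    (hz : is_flow T (flow_field f A) z0 z) :
  forall t : R, t \in `[0, T] -> enorm (x t - z t) <= enorm (x0 - z0).
Proof.
move=> t t0T; case: hx => <- dx; case: hz => <- dz.
have dw s (s0T : s \in `[0, T]) :=
  has_derivative_withinB (dx s s0T) (dz s s0T).
apply: (enorm_nonincreasing dw) => // s s0T.
(* The difference of the two fields is regrouped as minus the gradient difference plus [A s] applied
   to [x s - z s]. *)
rewrite /flow_field opprD addrACA -opprD -mulmxBr [(_ + _)^T]linearD mulmxDl mxE.
rewrite (skew_quadratic_form0 _ (Askew s s0T)) addr0 linearN mulNmx mxE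
oppr_le0.
exact: gradient_monotone (fconvex s s0T) (fdiff s s0T).
Qed.
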